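(* For every $n\ge1$, every $n$-person weakly totally tight game form $g: X_1\times\cdots\times X_n\to A$ is assignable.
   Context: Let $X_1,\dots,X_n$ and $A$ be finite nonempty sets. An $n$-person game form is a map $g: X_1\times\cdots\times X_n\to A$. $g$ is assignable if there exist functions $g_i: X_i\to A$, $i=1,\dots,n$, such that for every $x=(x_1,\dots,x_n)\in X_1\times\cdots\times X_n$ there is $i$ with $g(x)=g_i(x_i)$. For $i\in[n]$ write $X_{-i}=\prod_{t\neq i}X_t$, and for $s\in X_i$, $y\in X_{-i}$ write $(s,y)$ for the profile with $i$-th coordinate $s$ and other coordinates $y$. $g$ is weakly totally tight (WTT) if for every $i\in[n]$, all $s\neq s'$ in $X_i$ and all $y\neq y'$ in $X_{-i}$, at least one of the equalities $g(s,y)=g(s,y')$, $g(s,y)=g(s',y)$, $g(s',y')=g(s',y)$, $g(s',y')=g(s,y')$ holds. *)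

(* Defs.v *)
From mathcomp Require Import all_boot.
Set Implicit Arguments. Unset Strict Implicit. Unset Printing Implicit Defensive.

Definition profile (n : nat) (X : 'I_n -> finType) := forall i : 'I_n, X i.

(* (s, y): the profile whose i-th coordinate is s and whose other
   coordinates are those of y (the i-th coordinate of y is ignored, so that
   y represents an element of X_{-i}). *)
Definition upd (n : nat) (X : 'I_n -> finType) (i : 'I_n) (s : X i)
    (y : profile X) : profile X :=
  fun j => match @eqP _ i j with
           | ReflectT e => eq_rect i (fun k => X k) s j e
           | ReflectF _ => y j
           end.

(* y and y' represent different elements of X_{-i}. *)
Definition differ_off (n : nat) (X : 'I_n -> finType) (i : 'I_n)
    (y y' : profile X) : Prop :=
  exists j : 'I_n, j != i /\ y j <> y' j.

Definition game_form (n : nat) (X : 'I_n -> finType) (A : finType) :=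
  profile X -> A.

Definition assignable (n : nat) (X : 'I_n -> finType) (A : finType)
    (g : game_form X A) : Prop :=
  exists gi : forall i : 'I_n, X i -> A,
    forall x : profile X, exists i : 'I_n, g x = gi i (x i).

Definition WTT (n : nat) (X : 'I_n -> finType) (A : finType)
    (g : game_form X A) : Prop :=
  forall (i : 'I_n) (s s' : X i) (y y' : profile X),
    s <> s' -> @differ_off n X i y y' ->
    g (@upd n X i s y) = g (@upd n X i s y') \/
    g (@upd n X i s y) = g (@upd n X i s' y) \/
    g (@upd n X i s' y') = g (@upd n X i s' y) \/
    g (@upd n X i s' y') = g (@upd n X i s y').

(* Main.v *)
Require Import Defs.
From mathcomp Require Import all_boot.
From Stdlib Require Import Classical FunctionalExtensionality.

(** Flattening [g] to a matrix with rows [X i] and columns the profiles of the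
    other players gives a totally tight two-person form, and such forms are
    assignable: there is [r i] such that any two rows [s], [s'] agree in every
    column in which neither [s] takes the value [r i s] nor [s'] takes [r i s'].
    Call a profile [x] bad if [g x] differs from every [r i (x i)].  If [x] is
    bad, then at every profile [z] the value of [g] is [g x] or some [r i (z i)]
    with [z i <> x i] ([cube_value]).  Hence all bad profiles have the same value
    [u], and it suffices to change the assignment of a single player, giving [u]
    to those of his strategies that occur in a bad profile. *)

Section TwoPerson.

Variables (R : finType) (Y : Type) (A : Type) (M : R -> Y -> A).

Hypothesis M_tight : forall s s' y y',
  M s y = M s y' \/ M s y = M s' y \/ M s' y' = M s' y \/ M s' y' = M s y'.

Definition const_where_differ (s s' : R) : Prop :=
  forall y y', M s y <> M s' y -> M s y' <> M s' y' -> M s y = M s y'.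

(** By tightness, two columns where [s] and [s'] differ agree in [s] or in [s']. If [s] takes two
    values there, at [y1] and [y2], then [s'] agrees on both; any third such column misses one of
    the two values of [s], so [s'] keeps its value there too. *)
Lemma const_where_differ_total s s' :
  const_where_differ s s' \/ const_where_differ s' s.
Proof.
case: (classic (const_where_differ s s')) => [|nc]; [by left | right].
have agree y y' : M s y <> M s' y -> M s y' <> M s' y' ->
    M s y = M s y' \/ M s' y = M s' y'.
  by move=> d d'; case: (M_tight s s' y y') => [|[|[|]]]; auto => e; case: d'.
move=> z1 z2 /nesym d1 /nesym d2; apply: NNPP => ne; apply: nc => y1 y2 e1 e2.
apply: NNPP => ney.
have [//|ey] := agree _ _ e1 e2.
have off z : M s z <> M s' z -> M s' z = M s' y1.
  move=> d; apply: NNPP => nz; apply: ney.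
  have [-> | //] := agree _ _ e1 d; last by move=> e; case: nz.
  by have [-> | e] := agree _ _ e2 d; last by case: nz; rewrite ey.
by apply: ne; rewrite off // off.
Qed.

(** Given a base row [s0], each row gets its constant value off [s0]. Otherwise every [s] has a row
    [t] that varies where they differ, so [s] is constant there, and that constant is [r s]. *)
Lemma two_person_assignable (a0 : A) :
  exists r : R -> A,
    forall s s' y, M s y = M s' y \/ M s y = r s \/ M s' y = r s'.
Proof.
case: (classic (exists s0, forall s, const_where_differ s s0))
    => [[s0 base] | nobase].
  have [r rP] : exists r : R -> A, forall s y, M s y <> M s0 y -> M s y = r s.
    apply: (@fin_all_exists _ (fun=> A)
      (fun s v => forall y, M s y <> M s0 y -> M s y = v)) => s.
    case: (classic (exists y, M s y <> M s0 y)) => [[y d]|nd].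
      by exists (M s y) => y' d'; apply: base.
    by exists a0 => y d; case: nd; exists y.
  exists r => s s' y.
  case: (classic (M s y = M s0 y)) => [e|/rP]; last by auto.
  by case: (classic (M s' y = M s0 y)) => [e'|/rP]; [left; rewrite e e' | auto].
(* The value of [s] on its difference set with some [t], where [t] is not
   constant, is forced, and does not depend on [t] by [strict_uniq]. *)
pose strict s t v :=
  (forall y, M s y <> M t y -> M s y = v) /\ ~ const_where_differ t s.
have strictI s t y : ~ const_where_differ t s -> M s y <> M t y ->
    strict s t (M s y).
  move=> nc d; split=> // y' d'.
  by have [c|//] := const_where_differ_total s t; apply: c.
have differ s t : ~ const_where_differ t s -> exists y, M s y <> M t y.
  move=> nc; apply: NNPP => nd; apply: nc => y y' d.
  by case: nd; exists y => e; case: d.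
(* If the values differ, [s] agrees with [t'] where it differs from [t], and conversely. Totality
   for [t] and [t'] then makes one of them constant where it differs from [s]. *)
have strict_uniq s t t' v v' : strict s t v -> strict s t' v' -> v = v'.
  move=> [sv nc] [sv' nc']; apply: NNPP => ne.
  have same y : M s y <> M t y -> M s y = M t' y.
    move=> d; apply: NNPP => d'; apply: ne; by rewrite -(sv _ d) (sv' _ d').
  have same' y : M s y <> M t' y -> M s y = M t y.
    move=> d; apply: NNPP => d'; apply: ne; by rewrite -(sv' _ d) (sv _ d').
  case: (const_where_differ_total t t') => c.
    apply: nc => y y' /nesym d /nesym d'.
    by apply: c; [rewrite -(same _ d) | rewrite -(same _ d')]; apply: nesym.
  apply: nc' => y y' /nesym d /nesym d'.
  by apply: c; [rewrite -(same' _ d) | rewrite -(same' _ d')]; apply: nesym.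
have [r rP] : exists r : R -> A, forall s, exists t, strict s t (r s).
  apply: (@fin_all_exists _ (fun=> A) (fun s v => exists t, strict s t v)) => s.
  have [t nc] : exists t, ~ const_where_differ t s.
    by apply: not_all_ex_not => base; apply: nobase; exists s.
  by have [y d] := differ _ _ nc; exists (M s y), t; apply: strictI.
(* Here [s] agrees with [t] at [y], and with [s'] wherever it differs from [t]. Hence [t] also
   varies against [s'], which forces the value of [s'] at [y]. *)
have cover s s' y : const_where_differ s s' ->
    M s y <> M s' y -> M s y <> r s -> M s' y = r s'.
  move=> c d ne; have [t [sr nc]] := rP s.
  have [t' st'] := rP s'.
  have disj z : M s z <> M t z -> M s z = M s' z.
    by move=> dz; apply: NNPP => dz'; apply: ne; rewrite (c _ _ d dz') sr.
  have ety : M s y = M t y by apply: NNPP => dt; apply: ne; apply: sr.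
  have nc' : ~ const_where_differ t s'.
    move=> ct; apply: nc => z z' /nesym dz /nesym dz'.
    by apply: ct; apply: nesym; [rewrite -disj | rewrite -disj].
  apply: (strict_uniq s' t t') => //; apply: strictI => //.
  by rewrite -ety; apply: nesym.
exists r => s s' y.
case: (classic (M s y = M s' y)) => [|d]; [by left | right].
case: (const_where_differ_total s s') => c.
  by case: (classic (M s y = r s)) => [|ne]; [left | right; apply: cover ne].
case: (classic (M s' y = r s')) => [|ne]; [by right | left].
by apply: cover c (nesym d) ne.
Qed.

End TwoPerson.

(* [a S] stands for the value at the vertex [S] of the cube spanned by a bad
   profile (the vertex [set0], where the assignment is [v]) and another one
   (where the assignment is [w]). *)
Lemma cube_value (I : finType) (A : Type) (u : A) (v w : I -> A)
    (a : {set I} -> A) :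
  (forall i, u <> v i) -> a set0 = u ->
  (forall i (S : {set I}), i \in S -> a (S :\ i) = a S \/ a (S :\ i) = v i \/ a S = w i) ->
  (forall i (S K : {set I}), i \in S -> i \in K ->
     a (S :\ i) = a (K :\ i) \/ a (S :\ i) = a S \/
     a K = a S \/ a K = a (K :\ i)) ->
  forall S, a S = u \/ exists2 i, i \in S & a S = w i.
Proof.
move=> uv a0 edge square S; have [k] := ubnP #|S|.
elim: k S => // k IH K ltK; apply: NNPP => bad.
(* [K] is a counterexample of least size. *)
have below (S : {set I}) : S \proper K -> a K <> a S.
  move=> SK e; apply: bad; rewrite e.
  have [|->|[i iS aS]] := IH S; [|by left|].
    by apply: leq_trans (proper_card SK) _; rewrite -ltnS.
  by right; exists i => //; apply: (subsetP (proper_sub SK)).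
have top i : i \in K -> a (K :\ i) = v i.
  move=> iK; have [e|[//|e]] := edge i K iK.
    by case: (below (K :\ i)); rewrite ?properD1.
  by case: bad; right; exists i.
(* With [a (K :\ i) = v i], the only option left in [square] carries [u] from [S :\ i] to [S].
   Taking [K :\ i] itself for [S] then contradicts [uv]. *)
have propu (S : {set I}) : S \proper K -> a S = u.
  have [m] := ubnP #|S|; elim: m S => // m IHm S ltS SK.
  have [->//|[i iS]] := set_0Vmem S.
  have iK := subsetP (proper_sub SK) i iS.
  have aSi : a (S :\ i) = u.
    apply: IHm; last exact: sub_proper_trans (subsetDl _ _) SK.
    by rewrite -ltnS; apply: leq_trans ltS; rewrite ltnS proper_card ?properD1.
  have [e|[e|[e|e]]] := square i S K iS iK.
  - by case: (uv i); rewrite -(top i iK) -e.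
  - by rewrite -e.
  - by case: (below S).
  - by case: (below (K :\ i)); rewrite ?properD1.
have [K0|[i iK]] := set_0Vmem K; first by apply: bad; left; rewrite K0.
by apply: (uv i); rewrite -(top i iK) propu ?properD1.
Qed.

Section GameForm.

Variables (n : nat) (X : 'I_n -> finType).

Lemma upd_eq i (s : X i) (y : profile X) : upd s y i = s.
Proof.
rewrite /upd; case: eqP => // e.
by rewrite (eq_axiomK e).
Qed.

Lemma upd_neq i j (s : X i) (y : profile X) : i != j -> upd s y j = y j.
Proof. by rewrite /upd; case: eqP. Qed.

Definition mix (x z : profile X) (S : {set 'I_n}) : profile X :=
  fun j => if j \in S then z j else x j.

Lemma mix_updl x z (S : {set 'I_n}) i : mix x z (S :\ i) = upd (x i) (mix x z S).
Proof.
apply: functional_extensionality_dep => j.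
have [<-|ne] := eqVneq i j; first by rewrite upd_eq /mix setD11.
by rewrite upd_neq // /mix in_setD1 eq_sym ne.
Qed.

Lemma mix_updr x z (S : {set 'I_n}) i :
  i \in S -> mix x z S = upd (z i) (mix x z S).
Proof.
move=> iS; apply: functional_extensionality_dep => j.
have [<-|ne] := eqVneq i j; first by rewrite upd_eq /mix iS.
by rewrite upd_neq.
Qed.

Variables (A : finType) (g : game_form X A).
Hypothesis g_WTT : WTT g.

Lemma WTT_tight i (s s' : X i) (y y' : profile X) :
  g (upd s y) = g (upd s y') \/ g (upd s y) = g (upd s' y) \/
  g (upd s' y') = g (upd s' y) \/ g (upd s' y') = g (upd s y').
Proof.
have [->|/eqP ne] := eqVneq s s'; first by right; left.
case: (classic (differ_off i y y')) => [|same]; first exact: g_WTT.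
left; congr g; apply: functional_extensionality_dep => j.
have [<-|nij] := eqVneq i j; first by rewrite !upd_eq.
rewrite !upd_neq //; apply: NNPP => ney; apply: same.
by exists j; rewrite eq_sym.
Qed.

Variable r : forall i, X i -> A.
Hypothesis rP : forall i (s s' : X i) (y : profile X),
  g (upd s y) = g (upd s' y) \/ g (upd s y) = r i s \/ g (upd s' y) = r i s'.

Definition bad (x : profile X) : Prop := forall i, g x <> r i (x i).

Lemma value_off_bad x z : bad x ->
  g z = g x \/ exists2 i, z i <> x i & g z = r i (z i).
Proof.
move=> badx; pose K := [set j | z j != x j].
have Kz : mix x z K = z.
  apply: functional_extensionality_dep => j; rewrite /mix inE.
  by have [->|] := eqVneq.
suff : g (mix x z K) = g x \/ exists2 i, i \in K & g (mix x z K) = r i (z i).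
  rewrite Kz => -[|[i]]; first by left.
  by rewrite inE => /eqP ne e; right; exists i.
apply: (@cube_value _ _ _ (fun i => r i (x i)) (fun i => r i (z i))
          (fun S => g (mix x z S))) => //.
- by congr g; apply: functional_extensionality_dep => j; rewrite /mix inE.
- move=> i S iS; rewrite mix_updl.
  by have := rP i (x i) (z i) (mix x z S); rewrite -(mix_updr x z S i iS).
move=> i S S' iS iS'; rewrite !mix_updl.
have := WTT_tight i (x i) (z i) (mix x z S) (mix x z S').
by rewrite -(mix_updr x z S i iS) -(mix_updr x z S' i iS').
Qed.

Lemma assignable_of_rows (i0 : 'I_n) : assignable g.
Proof.
have [[x0 bad0]|nobad] := classic (exists x, bad x); last first.
  exists r => x; apply: NNPP => nx; apply: nobad; exists x => i e.
  by apply: nx; exists i.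
have badE z : bad z -> g z = g x0.
  by move=> badz; have [|[i _ e]] := value_off_bad _ z bad0; last case: (badz i).
pose marked i (s : X i) := i = i0 /\ exists2 x, bad x & x i = s.
have [f fP] : exists f : forall i, X i -> A, forall i s,
    (marked i s -> f i s = g x0) /\ (~ marked i s -> f i s = r i s).
  apply: (@fin_all_exists _ (fun i => X i -> A) (fun i fi => forall s,
    (marked i s -> fi s = g x0) /\ (~ marked i s -> fi s = r i s))) => i.
  apply: (@fin_all_exists _ (fun=> A) (fun s v =>
    (marked i s -> v = g x0) /\ (~ marked i s -> v = r i s))) => s.
  by case: (classic (marked i s)) => ?; [exists (g x0) | exists (r i s)].
exists f => z.
case: (classic (bad z)) => [badz|].
  exists i0; rewrite (badE z badz) (proj1 (fP _ _)) //.
  by split=> //; exists z.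
move=> /not_all_not_ex [i gz].
case: (classic (marked i (z i))) => [mk|nmk]; last first.
  by exists i; rewrite (proj2 (fP _ _)).
(* The bad profile [x] shares coordinate [i0] with [z], so a coordinate [j] where they differ
   belongs to a player whose assignment is unchanged. *)
have [ei [x badx xi]] := mk.
have [e|[j ne e]] := value_off_bad _ z badx.
  by exists i; rewrite (proj1 (fP _ _)) // e badE.
exists j; rewrite (proj2 (fP _ _)) // => -[ej _].
by apply: ne; rewrite ej -ei.
Qed.

End GameForm.

Theorem mainTheorem10 (n : nat) (X : 'I_n -> finType) (A : finType)
    (hn : 1 <= n) (hX : forall i : 'I_n, 0 < #|X i|) (hA : 0 < #|A|)
    (g : game_form X A) :
  WTT g -> assignable g.
Proof.
move=> g_WTT; have /card_gt0P [a0 _] := hA.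
have [r rP] : exists r : forall i, X i -> A, forall i (s s' : X i) y,
    g (upd s y) = g (upd s' y) \/ g (upd s y) = r i s \/ g (upd s' y) = r i s'.
  apply: (@fin_all_exists _ (fun i => X i -> A) (fun i ri => forall s s' y,
    g (upd s y) = g (upd s' y) \/ g (upd s y) = ri s \/ g (upd s' y) = ri s'))
    => i.
  (* Full profiles can index the columns, since [upd] overwrites coordinate [i]. *)
  apply: (two_person_assignable (X i) (profile X) A (fun s y => g (upd s y))) => //.
  exact: WTT_tight.
exact: (assignable_of_rows _ _ _ _ g_WTT r rP (Ordinal hn)).
Qed.
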